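(* Let $(N,\preceq,F)$ be a transitive-closed description of a simply dependent multimodal logic. Then the sequent calculus $\mathsf{G}_{(N,\preceq,F)}$ extended with the contraction and weakening rules (and without cut) is complete for the logic $\mathcal{L}_{(N,\preceq,F)}$: for every formula $A$, if $A\in\mathcal{L}_{(N,\preceq,F)}$ then the sequent $\;\Rightarrow A$ is derivable in this calculus.
   Context: A description is a triple $(N,\preceq,F)$ where $N$ is a finite set of natural numbers, $\preceq$ is a partial order on $N$, and $F(i)$ (for $i\in N$) is the extension of modal logic $\mathsf{K}$ by some subset of $\mathsf{D}: \neg\Box\bot$, $\mathsf{T}: \Box A\to A$, $\mathsf{4}: \Box A\to\Box\Box A$; $\mathsf{KAx}\subseteq F(i)$ means $F(i)$ proves every theorem of $\mathsf{K}+\mathsf{Ax}$. The language has propositional variables, $\bot,\top,\neg,\land,\lor,\to$ and $\Box_i$ for $i\in N$. The logic $\mathcal{L}_{(N,\preceq,F)}$ is the smallest set of formulas containing the propositional tautologies, for each $i$ the axiom $\Box_i(A\to B)\to(\Box_iA\to\Box_iB)$ and the instances for $\Box_i$ of the extra axioms of $F(i)$, the axioms $\Box_jA\to\Box_iA$ whenever $i\preceq j$, and closed under modus ponens and necessitation for each $\Box_i$. The description is transitive-closed if $i\preceq j$ and $\mathsf{K4}\subseteq F(i)$ imply $\mathsf{K4}\subseteq F(j)$. Standing assumption of the paper: for all $i\preceq j$, $\mathsf{KD}\subseteq F(i)$ implies $\mathsf{KD}\subseteq F(j)$ and $\mathsf{KT}\subseteq F(i)$ implies $\mathsf{KT}\subseteq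 F(j)$. Notation: $\uparrow i=\{j\in N: i\preceq j\}$, $\uparrow^{4} i=\{j\in\uparrow i:\mathsf{K4}\subseteq F(j)\}$, $\uparrow^{\neg4}i=\uparrow i\setminus\uparrow^4 i$; $\Box_j\Gamma=\{\Box_jB: B\in\Gamma\}$. Sequents $\Gamma\Rightarrow\Delta$ are pairs of finite multisets. Propositional calculus $\mathsf{G}$: initial sequents $\Gamma,p\Rightarrow p,\Delta$ ($p$ atomic), $\Gamma,\bot\Rightarrow\Delta$, $\Gamma\Rightarrow\top,\Delta$; the usual invertible two-sided rules: $\neg_L$ ($\Gamma\Rightarrow A,\Delta$ / $\Gamma,\neg A\Rightarrow\Delta$), $\neg_R$ ($\Gamma,A\Rightarrow\Delta$ / $\Gamma\Rightarrow\neg A,\Delta$), $\lor_L$ ($\Gamma,A\Rightarrow\Delta$ and $\Gamma,B\Rightarrow\Delta$ / $\Gamma,A\lor B\Rightarrow\Delta$), $\lor_R$ ($\Gamma\Rightarrow A,B,\Delta$ / $\Gamma\Rightarrow A\lor B,\Delta$), $\land_L$ ($\Gamma,A,B\Rightarrow\Delta$ / $\Gamma,A\land B\Rightarrow\Delta$), $\land_R$ ($\Gamma\Rightarrow A,\Delta$ and $\Gamma\Rightarrow B,\Delta$ / $\Gamma\Rightarrow A\land B,\Delta$), $\to_L$ ($\Gamma,B\Rightarrow\Delta$ and $\Gamma\Rightarrow A,\Delta$ / $\Gamma,A\to B\Rightarrow\Delta$), $\to_R$ ($\Gamma,A\Rightarrow B,\Delta$ / $\Gamma\Rightarrow A\to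 B,\Delta$). Contraction and weakening are the usual left and right structural rules. $\mathsf{G}_{(N,\preceq,F)}$ is $\mathsf{G}$ plus, with $\Omega,\Xi,\Gamma_j,\Sigma_j$ arbitrary finite multisets: for every $i\in N$ the rule $\mathsf{k}_i$: from $\{\Box_j\Gamma_j,\Sigma_j: j\in\uparrow^4 i\},\{\Sigma_j: j\in\uparrow^{\neg4}i\}\Rightarrow A$ infer $\Omega,\{\Box_j\Gamma_j,\Box_j\Sigma_j: j\in\uparrow^4 i\},\{\Box_j\Sigma_j: j\in\uparrow^{\neg4}i\}\Rightarrow\Box_iA,\Xi$; for every $i$ with $\mathsf{KD}\subseteq F(i)$ the rule $\mathsf{d}_i$: from $\{\Box_j\Gamma_j,\Sigma_j: j\in\uparrow^4 i\},\{\Sigma_j: j\in\uparrow^{\neg4}i\}\Rightarrow\;$ infer $\Omega,\{\Box_j\Gamma_j,\Box_j\Sigma_j: j\in\uparrow^4 i\},\{\Box_j\Sigma_j: j\in\uparrow^{\neg4}i\}\Rightarrow\Xi$; for every $i$ with $\mathsf{KT}\subseteq F(i)$ the rule $\mathsf{t}_i$: from $\Omega,\{\Sigma_j: j\in\uparrow i\}\Rightarrow\Xi$ infer $\Omega,\{\Box_j\Sigma_j: j\in\uparrow i\}\Rightarrow\Xi$. *)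

(* Defs.v *)
From HB Require Import structures.
From mathcomp Require Import all_boot finmap multiset boolp.

Set Implicit Arguments.
Unset Strict Implicit.
Unset Printing Implicit Defensive.

Local Open Scope fset_scope.
Local Open Scope mset_scope.

Inductive form (I : Type) : Type :=
| Var of nat
| Bot
| Top
| Neg of form I
| And of form I & form I
| Or of form I & form I
| Imp of form I & form I
| Box of I & form I.

Arguments Var {I} _.
Arguments Bot {I}.
Arguments Top {I}.

(* {mset form I} needs a choiceType structure on formulas. *)
Section FormChoice.

Variable I : Type.

Fixpoint tree_of_form (A : form I) : GenTree.tree (nat + I) :=
  match A with
  | Var p => GenTree.Leaf (inl p)
  | Bot => GenTree.Node 0 [::]
  | Top => GenTree.Node 1 [::]
  | Neg B => GenTree.Node 2 [:: tree_of_form B]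
  | And B C => GenTree.Node 3 [:: tree_of_form B; tree_of_form C]
  | Or B C => GenTree.Node 4 [:: tree_of_form B; tree_of_form C]
  | Imp B C => GenTree.Node 5 [:: tree_of_form B; tree_of_form C]
  | Box i B => GenTree.Node 6 [:: GenTree.Leaf (inr i); tree_of_form B]
  end.

Fixpoint form_of_tree (t : GenTree.tree (nat + I)) : option (form I) :=
  match t with
  | GenTree.Leaf (inl p) => Some (Var p)
  | GenTree.Node 0 [::] => Some Bot
  | GenTree.Node 1 [::] => Some Top
  | GenTree.Node 2 [:: t1] => omap (@Neg I) (form_of_tree t1)
  | GenTree.Node 3 [:: t1; t2] =>
      obind (fun B => omap (And B) (form_of_tree t2)) (form_of_tree t1)
  | GenTree.Node 4 [:: t1; t2] =>
      obind (fun B => omap (Or B) (form_of_tree t2)) (form_of_tree t1)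
  | GenTree.Node 5 [:: t1; t2] =>
      obind (fun B => omap (Imp B) (form_of_tree t2)) (form_of_tree t1)
  | GenTree.Node 6 [:: GenTree.Leaf (inr i); t1] =>
      omap (Box i) (form_of_tree t1)
  | _ => None
  end.

Lemma tree_of_formK : pcancel tree_of_form form_of_tree.
Proof.
by elim=> [p|||B /= ->|B /= -> C /= ->|B /= -> C /= ->|B /= -> C /= ->
          |i B /= ->].
Qed.

End FormChoice.

HB.instance Definition _ (I : choiceType) :=
  Choice.copy (form I) (pcan_type (@tree_of_formK I)).

(* Variables and boxed formulas are treated as atoms, so that [tautology]
   describes all modal substitution instances of propositional tautologies. *)
Fixpoint eval (I : Type) (v : form I -> bool) (A : form I) : bool :=
  match A with
  | Var _ | Box _ _ => v A
  | Bot => false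
  | Top => true
  | Neg B => ~~ eval v B
  | And B C => eval v B && eval v C
  | Or B C => eval v B || eval v C
  | Imp B C => eval v B ==> eval v C
  end.

Definition tautology (I : Type) (A : form I) : Prop :=
  forall v : form I -> bool, eval v A.

Inductive hilbert (I : Type) (Ax : form I -> Prop) : form I -> Prop :=
| hilbert_taut A : tautology A -> hilbert Ax A
| hilbert_K i A B :
    hilbert Ax (Imp (Box i (Imp A B)) (Imp (Box i A) (Box i B)))
| hilbert_ax A : Ax A -> hilbert Ax A
| hilbert_mp A B : hilbert Ax (Imp A B) -> hilbert Ax A -> hilbert Ax B
| hilbert_nec i A : hilbert Ax A -> hilbert Ax (Box i A).

Inductive modal_axiom : Set := axD | axT | ax4.

Definition axiom_instance (I : Type) (a : modal_axiom) (i : I) (A : form I) :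
    form I :=
  match a with
  | axD => Neg (Box i Bot)
  | axT => Imp (Box i A) A
  | ax4 => Imp (Box i A) (Box i (Box i A))
  end.

(* The unimodal logic K + S; its language has the single modality [Box tt]. *)
Definition unimodal_logic (S : modal_axiom -> Prop) : form unit -> Prop :=
  hilbert (fun B => exists2 a, S a & exists C, B = axiom_instance a tt C).

(* [extra i] is the set of axioms extending K to the logic F(i). *)
Record description : Type := Description {
  modality : {fset nat};
  below : rel modality;
  extra : modality -> modal_axiom -> Prop;
  below_refl : reflexive below;
  below_anti : antisymmetric below;
  below_trans : transitive below
}.

Definition F (D : description) (i : modality D) : form unit -> Prop :=
  unimodal_logic (extra i).

(* K + a is included in F(i). *)
Definition contains (a : modal_axiom) (D : description) (i : modality D) : Prop :=
  forall A : form unit, unimodal_logic (eq a) A -> F i A.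

Definition persistent (a : modal_axiom) (D : description) : Prop :=
  forall i j : modality D, below i j -> contains a i -> contains a j.

Definition transitive_closed (D : description) : Prop := persistent ax4 D.

Inductive logic_axiom (D : description) : form (modality D) -> Prop :=
| logic_extra i a A : extra i a -> logic_axiom (axiom_instance a i A)
| logic_inter i j A : below i j -> logic_axiom (Imp (Box j A) (Box i A)).

Definition logic (D : description) : form (modality D) -> Prop :=
  hilbert (@logic_axiom D).

HB.instance Definition _ (K : choiceType) :=
  Monoid.isComLaw.Build {mset K} mset0 (@msetD K)
    (@msetDA K) (@msetDC K) (@mset0D K).

Definition mset_map (S T : choiceType) (f : S -> T) (M : {mset S}) : {mset T} :=
  seq_mset [seq f x | x <- enum_mset M].

Section Calculus.

Variable D : description.

Implicit Types (i j : modality D) (p : nat) (A B : form (modality D)).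
Implicit Types Gam Del Om Xi : {mset form (modality D)}.
Implicit Types G S : modality D -> {mset form (modality D)}.

Definition boxes j Gam : {mset form (modality D)} := mset_map (Box j) Gam.

Definition up4 i j : bool := below i j && `[< contains ax4 j >].
Definition upn4 i j : bool := below i j && ~~ `[< contains ax4 j >].

Definition modal_premise i G S : {mset form (modality D)} :=
  \big[msetD/mset0]_(j | up4 i j) (boxes j (G j) `+` S j)
  `+` \big[msetD/mset0]_(j | upn4 i j) S j.

Definition modal_conclusion i G S : {mset form (modality D)} :=
  \big[msetD/mset0]_(j | up4 i j) (boxes j (G j) `+` boxes j (S j))
  `+` \big[msetD/mset0]_(j | upn4 i j) boxes j (S j).

Inductive derivable :
    {mset form (modality D)} -> {mset form (modality D)} -> Prop :=
| rule_init Gam Del p : derivable (Var p +` Gam) (Var p +` Del)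
| rule_bot Gam Del : derivable (Bot +` Gam) Del
| rule_top Gam Del : derivable Gam (Top +` Del)
| rule_negL Gam Del A : derivable Gam (A +` Del) -> derivable (Neg A +` Gam) Del
| rule_negR Gam Del A : derivable (A +` Gam) Del -> derivable Gam (Neg A +` Del)
| rule_orL Gam Del A B :
    derivable (A +` Gam) Del -> derivable (B +` Gam) Del ->
    derivable (Or A B +` Gam) Del
| rule_orR Gam Del A B :
    derivable Gam (A +` (B +` Del)) -> derivable Gam (Or A B +` Del)
| rule_andL Gam Del A B :
    derivable (A +` (B +` Gam)) Del -> derivable (And A B +` Gam) Del
| rule_andR Gam Del A B :
    derivable Gam (A +` Del) -> derivable Gam (B +` Del) ->
    derivable Gam (And A B +` Del)
| rule_impL Gam Del A B :
    derivable (B +` Gam) Del -> derivable Gam (A +` Del) ->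
    derivable (Imp A B +` Gam) Del
| rule_impR Gam Del A B :
    derivable (A +` Gam) (B +` Del) -> derivable Gam (Imp A B +` Del)
| rule_k i G S Om Xi A :
    derivable (modal_premise i G S) [mset A] ->
    derivable (Om `+` modal_conclusion i G S) (Box i A +` Xi)
| rule_d i G S Om Xi :
    contains axD i ->
    derivable (modal_premise i G S) mset0 ->
    derivable (Om `+` modal_conclusion i G S) Xi
| rule_t i S Om Xi :
    contains axT i ->
    derivable (Om `+` \big[msetD/mset0]_(j | below i j) S j) Xi ->
    derivable (Om `+` \big[msetD/mset0]_(j | below i j) boxes j (S j)) Xi
| rule_contrL Gam Del A :
    derivable (A +` (A +` Gam)) Del -> derivable (A +` Gam) Del
| rule_contrR Gam Del A :
    derivable Gam (A +` (A +` Del)) -> derivable Gam (A +` Del)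
| rule_weakL Gam Del A : derivable Gam Del -> derivable (A +` Gam) Del
| rule_weakR Gam Del A : derivable Gam Del -> derivable Gam (A +` Del).

End Calculus.

(* Main.v *)
Require Import Defs.
From mathcomp Require Import all_boot finmap multiset.
From mathcomp Require Import boolp.

(** Completeness is obtained semantically.  Worlds are underivable sequents
    that cannot be enlarged, on either side, by a subformula of the goal without
    becoming derivable.  In the presence of contraction and weakening only the
    supports of the two multisets matter, so each rule of the calculus, read
    upwards, gives one clause of the truth lemma or one frame property: [k_i]
    provides the successors that refute [Box i B], [d_i] seriality, and [t_i]
    reflexivity.  Transitive closure of the description makes the [i]-th relation
    transitive when the logic of [i] contains [4], because then every [j] above
    [i] transmits its boxed formulas along that relation. *)

Set Implicit Arguments.
Unset Strict Implicit.
Unset Printing Implicit Defensive.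

Local Open Scope mset_scope.

(** * Kripke semantics for the Hilbert system *)

Section Kripke.

Variables (I W : Type) (R : I -> W -> W -> Prop) (V : nat -> W -> Prop).

Fixpoint forces (w : W) (A : form I) : Prop :=
  match A with
  | Var p => V p w
  | Bot => False
  | Top => True
  | Neg B => ~ forces w B
  | And B C => forces w B /\ forces w C
  | Or B C => forces w B \/ forces w C
  | Imp B C => forces w B -> forces w C
  | Box i B => forall v, R i w v -> forces v B
  end.

(** [eval] treats variables and boxed formulas as atoms, so forcing at a fixed world is one of its
    Boolean valuations; hence tautologies are forced everywhere. *)
Lemma eval_forces w A : eval (fun B => `[< forces w B >]) A = `[< forces w A >].
Proof.
elim: A => //=.
- by rewrite (asboolF (fun H : False => H)).
- by rewrite asboolT.
- by move=> B ->; rewrite asbool_neg.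
- by move=> B -> C ->; rewrite asbool_and.
- by move=> B -> C ->; rewrite asbool_or.
- by move=> B -> C ->; rewrite asbool_imply.
Qed.

Lemma hilbert_sound (Ax : form I -> Prop) A :
  (forall B, Ax B -> forall w, forces w B) -> hilbert Ax A ->
  forall w, forces w A.
Proof.
move=> sound_Ax; elim=> {A} [A tautA|i A B|A /sound_Ax//|A B _ IHAB _ IHA|i A _ IH] w.
- by apply/asboolP; rewrite -eval_forces.
- by move=> /= wAB wA v Rwv; apply: wAB => //; apply: wA.
- exact: (IHAB w (IHA w)).
- by move=> v _; apply: IH.
Qed.

End Kripke.

Lemma hilbert_mono (I : Type) (Ax Ax' : form I -> Prop) A :
  (forall B, Ax B -> Ax' B) -> hilbert Ax A -> hilbert Ax' A.
Proof.
move=> sAx; elim=> {A}.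
- by move=> *; apply: hilbert_taut.
- by move=> *; apply: hilbert_K.
- by move=> A /sAx AxA; apply: hilbert_ax.
- by move=> A B _ ? _; apply: hilbert_mp.
- by move=> i A _; apply: hilbert_nec.
Qed.

(** The axioms of the logic come from [extra], whereas the modal rules are governed by [contains];
    this links the two. *)
Lemma extra_contains (D : description) (i : modality D) a :
  extra i a -> contains a i.
Proof.
move=> ia A; apply: hilbert_mono => B [b <- insB].
by exists a.
Qed.

(** * Multiset membership and subformulas *)

Lemma in_seq_mset (K : choiceType) (s : seq K) (x : K) :
  (x \in seq_mset s) = (x \in s).
Proof. exact: (perm_mem (perm_eq_seq_mset s)). Qed.

Lemma seq_mset_nil (K : choiceType) : seq_mset [::] = mset0 :> {mset K}.
Proof. by apply/msetP => x; rewrite mset_seqE mset0E. Qed.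

Lemma in_big_msetD (K : choiceType) (T : finType) (P : pred T)
    (M : T -> {mset K}) (x : K) :
  reflect (exists2 j, P j & x \in M j) (x \in \big[msetD/mset0]_(j | P j) M j).
Proof.
rewrite (big_morph (fun M => x \in M) (fun M1 M2 => in_msetD M1 M2 x) (in_mset0 x)) big_orE.
by apply: (iffP existsP) => [[j /andP[]]|[j Pj xj]]; exists j => //; apply/andP.
Qed.

Fixpoint subformulas (I : Type) (A : form I) : seq (form I) :=
  A :: match A with
       | Var _ | Bot | Top => [::]
       | Neg B | Box _ B => subformulas B
       | And B C | Or B C | Imp B C => subformulas B ++ subformulas C
       end.

Section Completeness.

Variable D : description.

Notation fm := (form (modality D)).

Implicit Types (i j : modality D) (A B C : fm) (Gam Del : {mset fm}).

Lemma mem_subformulas A : A \in subformulas A.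
Proof. by case: A => *; rewrite /= mem_head. Qed.

Lemma subformulas_trans A B :
  B \in subformulas A -> {subset subformulas B <= subformulas A}.
Proof.
(* Every [subformulas A] has the form [C :: s]. If [B] is the head, the inclusion is trivial, so
   only the tail is left to the induction. *)
have sub_cons (C : fm) (s : seq fm) :
    (B \in s -> {subset subformulas B <= s}) ->
    B \in C :: s -> subformulas C = C :: s ->
    {subset subformulas B <= C :: s}.
  rewrite inE => sub_s /predU1P[->|/sub_s sub] eC X; first by rewrite eC.
  by move=> /sub XB; rewrite inE XB orbT.
elim: A => [p|||A IHA|A IHA C IHC|A IHA C IHC|A IHA C IHC|i A IHA] inB;
  apply: sub_cons inB _ => //=; rewrite mem_cat => inB X XB; rewrite mem_cat.
all: by case/orP: inB => [/IHA|/IHC] sub; rewrite (sub X XB) ?orbT.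
Qed.

Lemma in_boxes j Gam A :
  reflect (exists2 B, B \in Gam & A = Box j B) (A \in boxes j Gam).
Proof. by rewrite in_seq_mset; apply: mapP. Qed.

(** * Structural rules up to support *)

Lemma derivable_weakenL (s : seq fm) Gam Del :
  derivable Gam Del -> derivable (seq_mset s `+` Gam) Del.
Proof.
elim: s => [|x s IHs] dGD; first by rewrite seq_mset_nil mset0D.
by rewrite mset_cons -msetDA; apply/rule_weakL/IHs.
Qed.

Lemma derivable_weakenR (s : seq fm) Gam Del :
  derivable Gam Del -> derivable Gam (seq_mset s `+` Del).
Proof.
elim: s => [|x s IHs] dGD; first by rewrite seq_mset_nil mset0D.
by rewrite mset_cons -msetDA; apply/rule_weakR/IHs.
Qed.

Lemma derivable_contractL (s : seq fm) Gam Del :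
  {subset s <= Gam} -> derivable (seq_mset s `+` Gam) Del -> derivable Gam Del.
Proof.
elim: s => [|x s IHs] sG; first by rewrite seq_mset_nil mset0D.
rewrite mset_cons -msetDA => dG; apply: IHs => [y ys|].
  by apply: sG; rewrite inE ys orbT.
have /msetB1K xE : x \in seq_mset s `+` Gam by rewrite in_msetD sG ?mem_head ?orbT.
by rewrite -xE; apply: rule_contrL; rewrite xE.
Qed.

Lemma derivable_contractR (s : seq fm) Gam Del :
  {subset s <= Del} -> derivable Gam (seq_mset s `+` Del) -> derivable Gam Del.
Proof.
elim: s => [|x s IHs] sD; first by rewrite seq_mset_nil mset0D.
rewrite mset_cons -msetDA => dD; apply: IHs => [y ys|].
  by apply: sD; rewrite inE ys orbT.
have /msetB1K xE : x \in seq_mset s `+` Del by rewrite in_msetD sD ?mem_head ?orbT.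
by rewrite -xE; apply: rule_contrR; rewrite xE.
Qed.

(** Weakening adds all of [Gam'] and [Del']; contraction then absorbs the old [Gam] and [Del],
    whatever their multiplicities. *)
Lemma derivable_subset Gam Gam' Del Del' :
  {subset Gam <= Gam'} -> {subset Del <= Del'} ->
  derivable Gam Del -> derivable Gam' Del'.
Proof.
move=> sG sD dGD.
apply: (derivable_contractL sG); apply: (derivable_contractR sD).
rewrite !seq_mset_id msetDC [Del `+` _]msetDC.
rewrite -[Gam']seq_mset_id -[Del']seq_mset_id.
exact/derivable_weakenL/derivable_weakenR.
Qed.

(** * Saturation of underivable sequents *)

Definition saturated (s : seq fm) Gam Del : Prop :=
  forall C, C \in s ->
    (C \in Gam \/ derivable (C +` Gam) Del) /\
    (C \in Del \/ derivable Gam (C +` Del)).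

(** The formulas of [s] are tried one by one on each side. A rejected formula stays rejected,
    because by [derivable_subset] derivability survives later enlargements. *)
Lemma saturation (s : seq fm) Gam Del :
  ~ derivable Gam Del ->
  exists Gam' Del', [/\ {subset Gam <= Gam'}, {subset Del <= Del'},
    ~ derivable Gam' Del' & saturated s Gam' Del'].
Proof.
elim: s Gam Del => [|C s IHs] Gam Del ndGD; first by exists Gam, Del; split=> // C; rewrite in_nil.
have [Gam1 [sG1 nd1 satL]] : exists Gam1, [/\ {subset Gam <= Gam1},
    ~ derivable Gam1 Del & C \in Gam1 \/ derivable (C +` Gam1) Del].
  have [dC|ndC] := pselect (derivable (C +` Gam) Del).
    by exists Gam; split=> //; right.
  exists (C +` Gam); split=> //; last by left; apply: mset1D1.
  by move=> x; apply: mset1Dr.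
have [Del1 [sD1 nd2 satR]] : exists Del1, [/\ {subset Del <= Del1},
    ~ derivable Gam1 Del1 & C \in Del1 \/ derivable Gam1 (C +` Del1)].
  have [dC|ndC] := pselect (derivable Gam1 (C +` Del)).
    by exists Del; split=> //; right.
  exists (C +` Del); split=> //; last by left; apply: mset1D1.
  by move=> x; apply: mset1Dr.
have [Gam' [Del' [sG' sD' nd' sat']]] := IHs _ _ nd2.
exists Gam', Del'; split=> //.
- by move=> x /sG1/sG'.
- by move=> x /sD1/sD'.
move=> X; rewrite inE => /predU1P[->|/sat'//]; split.
- case: satL => [/sG'|dC]; [by left|right; apply: derivable_subset dC].
    by move=> y; rewrite !in_mset1D => /orP[->//|/sG' ->]; rewrite orbT.
  by move=> y /sD1/sD'.
- case: satR => [/sD'|dC]; [by left|right; apply: derivable_subset dC => //].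
  by move=> y; rewrite !in_mset1D => /orP[->//|/sD' ->]; rewrite orbT.
Qed.

(** * Modal rules read upwards *)

Definition unbox Gam j : {mset fm} :=
  seq_mset (pmap (fun A => if A is Box k B then if k == j then Some B else None
                           else None) (enum_mset Gam)).

Lemma in_unbox Gam j B : (B \in unbox Gam j) = (Box j B \in Gam).
Proof.
rewrite in_seq_mset mem_pmap; apply/mapP/idP => [[A AG]|BG].
  by case: A AG => // k C; case: eqP => // -> ? [->].
by exists (Box j B); rewrite ?eqxx.
Qed.

(** With [unbox Gam] for both families of [k_i] and [d_i], the boxes in the conclusion add nothing
    to [Gam], so underivability passes to the premise. *)
Lemma modal_conclusion_unbox i Gam :
  {subset modal_conclusion i (unbox Gam) (unbox Gam) <= Gam}.
Proof.
move=> A; rewrite in_msetD => /orP[] /in_big_msetD[j _]; rewrite ?in_msetD.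
  by case/orP=> /in_boxes[B]; rewrite in_unbox => + ->.
by case/in_boxes=> B; rewrite in_unbox => + ->.
Qed.

(** The family [S] supplies [B] for every [j]; the family [G] supplies [Box j B] where [4] holds. *)
Lemma modal_premise_unbox i j Gam B : below i j -> Box j B \in Gam ->
  B \in modal_premise i (unbox Gam) (unbox Gam) /\
  (contains ax4 j -> Box j B \in modal_premise i (unbox Gam) (unbox Gam)).
Proof.
move=> ij BG; rewrite /modal_premise !in_msetD; split=> [|j4].
  have [j4|jn4] := asboolP (contains ax4 j).
    apply/orP; left; apply/in_big_msetD; exists j; first by apply/andP; split; last apply/asboolP.
    by rewrite in_msetD in_unbox BG orbT.
  apply/orP; right; apply/in_big_msetD; exists j; first by apply/andP; split; last apply/asboolP.
  by rewrite in_unbox.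
apply/orP; left; apply/in_big_msetD; exists j; first by apply/andP; split; last apply/asboolP.
by rewrite in_msetD; apply/orP; left; apply/in_boxes; exists B; rewrite ?in_unbox.
Qed.

Lemma derivable_t i j Gam Del B : contains axT i -> below i j ->
  Box j B \in Gam -> derivable (B +` Gam) Del -> derivable Gam Del.
Proof.
move=> iT ij BG dB.
(* [t_i] unboxes a whole family; a single [B] at index [j] suffices. Taking [Om] to be [Gam] keeps
   [Box j B] itself, and contraction absorbs the duplicate. *)
pose S k := if k == j then [mset B] else mset0 : {mset fm}.
apply: (@derivable_subset (Gam `+` \big[msetD/mset0]_(k | below i k) boxes k (S k)) _ Del) => //.
  move=> A; rewrite in_msetD => /orP[//|/in_big_msetD[k _ /in_boxes[C]]].
  by rewrite /S; case: eqP => [-> /mset1P-> ->//|_]; rewrite in_mset0.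
apply: rule_t iT _; apply: derivable_subset dB => // A.
rewrite in_mset1D in_msetD => /predU1P[->|->//]; apply/orP; right.
by apply/in_big_msetD; exists j; rewrite // /S eqxx mset11.
Qed.

(** * The canonical model *)

Section CanonicalModel.

Variable A0 : fm.

Record world := World {
  ante : {mset fm};
  succ : {mset fm};
  world_underivable : ~ derivable ante succ;
  world_saturated : saturated (subformulas A0) ante succ
}.

Implicit Types w v : world.

(** Ranging over all [j] above [i] makes the relation grow with [i]; carrying [Box j B] along where
    [4] holds yields transitivity. Only subformulas of [A0] count because worlds are saturated just
    for those, which reflexivity relies on. *)
Definition accessible i w v : Prop := forall j B, below i j ->
  Box j B \in subformulas A0 -> Box j B \in ante w ->
  B \in ante v /\ (contains ax4 j -> Box j B \in ante v).

Lemma world_extends Gam Del : ~ derivable Gam Del ->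
  exists w, {subset Gam <= ante w} /\ {subset Del <= succ w}.
Proof.
move=> /(saturation (subformulas A0))[G [S [sG sS nd sat]]].
by exists (World nd sat).
Qed.

Lemma accessible_extends i w Del :
  ~ derivable (modal_premise i (unbox (ante w)) (unbox (ante w))) Del ->
  exists2 v, accessible i w v & {subset Del <= succ v}.
Proof.
move=> /world_extends[v [sG sD]]; exists v => // j B ij _ Bw.
have [inB inBox] := modal_premise_unbox ij Bw.
by split=> [|/inBox]; apply: sG.
Qed.

Lemma accessible_box i w B : Box i B \in succ w ->
  exists2 v, accessible i w v & B \in succ v.
Proof.
move=> Bw.
have [|v wv sB] := @accessible_extends i w [mset B]; last first.
  by exists v => //; apply: sB; apply: mset11.
(* The side contexts are empty because [derivable_subset] does the weakening. *)
move=> /(rule_k mset0 mset0) dB; apply: (@world_underivable w).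
apply: derivable_subset dB; first by rewrite mset0D; apply: modal_conclusion_unbox.
by move=> x; rewrite msetD0 => /mset1P->.
Qed.

Lemma accessible_serial i w : contains axD i -> exists v, accessible i w v.
Proof.
move=> iD; have [|v wv _] := @accessible_extends i w mset0; last by exists v.
move=> /(rule_d mset0 mset0 iD) dB; apply: (@world_underivable w).
apply: derivable_subset dB; last by move=> x; rewrite in_mset0.
by rewrite mset0D; apply: modal_conclusion_unbox.
Qed.

Lemma sub_box j B : Box j B \in subformulas A0 -> B \in subformulas A0.
Proof.
by move/subformulas_trans; apply; rewrite /= inE mem_subformulas orbT.
Qed.

Lemma accessible_refl i w : contains axT i -> accessible i w w.
Proof.
move=> iT j B ij /sub_box subB Bw; split=> //.
have [[//|dB] _] := world_saturated w subB.
by case: (@world_underivable w); exact: (derivable_t iT ij Bw dB).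
Qed.

Lemma accessible_trans i u v w : transitive_closed D -> contains ax4 i ->
  accessible i u v -> accessible i v w -> accessible i u w.
Proof.
move=> tcD i4 uv vw j B ij subB Bu.
(* [tcD] lifts [4] from [i] to [j], so [Box j B] itself reaches [v] and is available for the second
   step. *)
by have [_ /(_ (tcD _ _ ij i4))] := uv j B ij subB Bu; apply: vw.
Qed.

Lemma accessible_mono i j w v : below i j -> accessible i w v -> accessible j w v.
Proof. by move=> ij wv k B jk; apply: wv; apply: below_trans ij jk. Qed.

Notation canonical_forces :=
  (forces accessible (fun p w => Var p \in ante w)).

(** Without cut a world may have a formula on neither side, hence two separate implications instead
    of an equivalence. *)
Lemma truth A w : A \in subformulas A0 ->
  (A \in ante w -> canonical_forces w A) /\
  (A \in succ w -> ~ canonical_forces w A).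
Proof.
have absL Gam w1 : {subset Gam <= ante w1} -> ~ derivable Gam (succ w1).
  by move=> sG /(derivable_subset sG (fun _ => id)); apply: world_underivable.
have absR Del w1 : {subset Del <= succ w1} -> ~ derivable (ante w1) Del.
  by move=> sD /(derivable_subset (fun _ => id) sD); apply: world_underivable.
(* On each side, either the induction hypothesis settles the truth value of [C], or adding [C] gives
   a derivable sequent. Below, the derivable options feed the rule of the connective and contradict
   underivability. *)
have dec C w1 : C \in subformulas A0 ->
    (C \in subformulas A0 -> (C \in ante w1 -> canonical_forces w1 C) /\
       (C \in succ w1 -> ~ canonical_forces w1 C)) ->
    (canonical_forces w1 C \/ derivable (C +` ante w1) (succ w1)) /\
    (~ canonical_forces w1 C \/ derivable (ante w1) (C +` succ w1)).
  move=> sC /(_ sC)[IHl IHr]; have [satL satR] := world_saturated w1 sC.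
  by split; [case: satL => [/IHl|]|case: satR => [/IHr|]]; [left|right|left|right].
(* The principal formula already lies in the world, so the conclusion of the rule has no new
   support. *)
have addS (x : fm) (M : {mset fm}) : x \in M -> {subset x +` M <= M}.
  by move=> xM y; rewrite in_mset1D => /predU1P[->|].
have addC (x y : fm) (M : {mset fm}) : {subset x +` M <= x +` (y +` M)}.
  by move=> z; rewrite !in_mset1D => /orP[->//|->]; rewrite !orbT.
elim: A w => [p|||A IHA|A IHA B IHB|A IHA B IHB|A IHA B IHB|i A IHA] w subA;
  have inS C : C \in subformulas _ -> C \in subformulas A0 := @subformulas_trans _ _ subA C.
- split=> //= inR inL; apply: (@world_underivable w).
  by rewrite -(msetB1K inR) -(msetB1K inL); apply: rule_init.
- by split=> [inL|_ []]; case: (absL _ _ (addS _ _ inL)); apply: rule_bot.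
- by split=> [//|inR]; case: (absR _ _ (addS _ _ inR)); apply: rule_top.
- have [decL decR] := dec _ w (inS A ltac:(by rewrite /= inE mem_subformulas orbT)) (IHA w).
  split=> [inL|inR] /=.
    case: decR => [//|dA].
    by case: (absL _ _ (addS _ _ inL)); apply: rule_negL.
  case: decL => [? /(_ _)//|dA].
  by case: (absR _ _ (addS _ _ inR)); apply: rule_negR.
- have [decAL decAR] := dec _ w (inS A ltac:(by rewrite /= inE mem_cat mem_subformulas orbT)) (IHA w).
  have [decBL decBR] := dec _ w (inS B ltac:(by rewrite /= inE mem_cat mem_subformulas !orbT)) (IHB w).
  split=> [inL|inR] /=.
    have absAB : ~ derivable (A +` (B +` ante w)) (succ w).
      by move=> dAB; apply: (absL _ _ (addS _ _ inL)); apply: rule_andL.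
    split.
      case: decAL => // dA; case: absAB.
      by apply: derivable_subset dA => //; apply: addC.
    by case: decBL => // dB; case: absAB; apply: rule_weakL.
  case: decAR => [nA [/nA]//|dA]; case: decBR => [nB [_ /nB]//|dB].
  by case: (absR _ _ (addS _ _ inR)); apply: rule_andR.
- have [decAL decAR] := dec _ w (inS A ltac:(by rewrite /= inE mem_cat mem_subformulas orbT)) (IHA w).
  have [decBL decBR] := dec _ w (inS B ltac:(by rewrite /= inE mem_cat mem_subformulas !orbT)) (IHB w).
  split=> [inL|inR] /=.
    case: decAL => [|dA]; [by left|]; case: decBL => [|dB]; [by right|].
    by case: (absL _ _ (addS _ _ inL)); apply: rule_orL.
  have absAB : ~ derivable (ante w) (A +` (B +` succ w)).
    by move=> dAB; apply: (absR _ _ (addS _ _ inR)); apply: rule_orR.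
  case.
    case: decAR => // dA; case: absAB.
    by apply: derivable_subset dA => //; apply: addC.
  by case: decBR => // dB; case: absAB; apply: rule_weakR.
- have [decAL decAR] := dec _ w (inS A ltac:(by rewrite /= inE mem_cat mem_subformulas orbT)) (IHA w).
  have [decBL decBR] := dec _ w (inS B ltac:(by rewrite /= inE mem_cat mem_subformulas !orbT)) (IHB w).
  split=> [inL|inR] /=.
    case: decBL => [//|dB]; case: decAR => [//|dA].
    by case: (absL _ _ (addS _ _ inL)); apply: rule_impL.
  have absAB : ~ derivable (A +` ante w) (B +` succ w).
    by move=> dAB; apply: (absR _ _ (addS _ _ inR)); apply: rule_impR.
  case: decAL => [fA|dA]; last by case: absAB; apply: rule_weakR.
  case: decBR => [nB /(_ fA)//|dB]; by case: absAB; apply: rule_weakL.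
- have sA := sub_box subA; split=> [inL v wv|inR fA].
    (* This is the clause of [accessible] with [j] equal to [i]. *)
    by apply: (IHA v sA).1; apply: (wv i A _ subA inL).1; apply: below_refl.
  have [v wv Av] := accessible_box inR.
  exact: (IHA v sA).2 Av (fA v wv).
Qed.

(** Seriality, reflexivity and transitivity validate [D], [T] and [4]; monotonicity in the index
    validates the interaction axioms. *)
Lemma logic_sound B w : transitive_closed D -> logic B -> canonical_forces w B.
Proof.
move=> tcD lB; apply: hilbert_sound lB w => {}B axB w.
case: axB w => [i [] C /extra_contains ia|i j C ij] w /=.
- by move=> wbot; have [v /wbot] := accessible_serial w ia.
- by move=> wC; apply: wC; apply: accessible_refl.
- by move=> wC v wv u vu; apply: wC; apply: accessible_trans wv vu.
- by move=> wC v wv; apply: wC; apply: accessible_mono wv.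
Qed.

End CanonicalModel.

End Completeness.

Theorem mainTheorem3 (D : description)
    (persistent_D : persistent axD D) (persistent_T : persistent axT D)
    (trans_closed : transitive_closed D) (A : form (modality D)) :
  logic A -> derivable mset0 [mset A]%mset.
Proof.
(* An underivable sequent with succedent [A] would extend to a world refuting [A] in the canonical
   model for the subformulas of [A]. *)
move=> lA; apply: contrapT => /(world_extends A)[w [_ sA]].
apply: (truth w (mem_subformulas A)).2; first by apply: sA; apply: mset11.
exact: logic_sound.
Qed.
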